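(* Consider the min-max-energy platooning problem with arbitrary $n$ and $m$ and arbitrary usage rates $\delta_j$, in which $S_{j1}C_j\ge\bar L$ for all $j$, where $\bar L$ is sufficiently large that every solution is feasible. Reindex the vehicles so that $\delta_1\le\cdots\le\delta_n$. The worst-case performance ratio of Algorithm HEU2 for this problem is bounded by $$\frac{\max_{1\le j\le n}\{\delta_j(1-\eta_j)\}}{\min_{1\le j\le n}\{\delta_j(1-\eta_j)\}};$$ that is, for every instance the objective value $Z^H$ of the solution generated by HEU2 and the optimal objective value $Z^*$ satisfy that $Z^H/Z^*$ is at most this quantity.
   Context: Setting. There are $n$ vehicles and $m$ road segments with lengths $D_1,\ldots,D_m>0$. Vehicle $j$ has battery capacity $C_j>0$, usage rate $\delta_j>0$, initial state of charge $S_{j1}\in[0,1]$, and minimum allowable state of charge $\beta_j$ with $0\le\beta_j<S_{j1}$. Platoon positions have usage-rate reductions $0\le\eta_1\le\cdots\le\eta_n<1$. A solution specifies for each segment $i$ a permutation of the positions; $j_i$ is the position of vehicle $j$ in segment $i$. The total energy usage of vehicle $j$ is $U_j=\delta_j\sum_{i=1}^mD_i(1-\eta_{j_i})$, and a solution is feasible if $S_{j1}-U_j/C_j\ge\beta_j$ for all $j$. The min-max-energy problem is to minimize $\max_jU_j$ over feasible solutions. The condition $S_{j1}C_j\ge\bar L$ means that initial energy levels are large enough that any solution is feasible, e.g. $\bar L\ge\beta_jC_j+\sum_{i=1}^mD_i(1-\eta_1)\delta_j$ for each $j$. Algorithm HEU2. Step 0: Reindex the segments so that $D_1\ge D_2\ge\cdots\ge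 D_m$. Let $E_{jh}$ denote the total energy used by vehicle $j$ after the first $h$ segments, with $E_{j0}=0$. Set $k=1$. Step 1: Assign the vehicles to the $n$ positions in segment $k$ so as to minimize the maximum energy usage of the vehicles over the first $k$ segments, by bottleneck matching: form the sorted set $G$ of distinct values $E_{j,k-1}+D_k\delta_j(1-\eta_i)$, $1\le i,j\le n$; by binary search over $G$ find the smallest $g\in G$ such that the bipartite graph joining vehicle $j$ to position $i$ whenever $E_{j,k-1}+D_k\delta_j(1-\eta_i)\le g$ has a matching with $n$ arcs; use such a matching as the assignment in segment $k$, and let $E_{jk}=E_{j,k-1}+D_k\delta_j(1-\eta_h)$, where $h$ is the position matched to vehicle $j$. Step 2: If $k=m$, stop and restore the original order of the segments; otherwise set $k=k+1$ and go to Step 1. *)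

(* Defs.v *)
From HB Require Import structures.
From mathcomp Require Import all_boot all_order all_algebra all_fingroup.

Set Implicit Arguments.
Unset Strict Implicit.
Unset Printing Implicit Defensive.

Import Order.TTheory GRing.Theory Num.Theory.
Local Open Scope ring_scope.

(* Vehicles and positions are both indexed by 'I_n, segments by 'I_m; indices
   start at 0, so the lead position is the one with index 0. *)
Record platooning (R : realFieldType) (n m : nat) := Platooning {
  len : 'I_m -> R;          (* D *)
  capacity : 'I_n -> R;     (* C *)
  rate : 'I_n -> R;         (* delta *)
  soc : 'I_n -> R;          (* S_{j1}, the initial state of charge *)
  min_soc : 'I_n -> R;      (* beta *)
  reduction : 'I_n -> R;    (* eta, indexed by positions *)
  len_gt0 : forall i, 0 < len i;
  capacity_gt0 : forall j, 0 < capacity j;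
  rate_gt0 : forall j, 0 < rate j;
  soc_ge0 : forall j, 0 <= soc j;
  soc_le1 : forall j, soc j <= 1;
  min_soc_ge0 : forall j, 0 <= min_soc j;
  min_soc_lt : forall j, min_soc j < soc j;
  reduction_ge0 : forall p, 0 <= reduction p;
  reduction_mono : forall p q : 'I_n, (p <= q)%N -> reduction p <= reduction q;
  reduction_lt1 : forall p, reduction p < 1
}.

(* [s i j] is the position of vehicle j in segment i. *)
Definition solution (n m : nat) := {ffun 'I_m -> {perm 'I_n}}.

Definition max_of (R : realFieldType) (n : nat) (f : 'I_n.+1 -> R) : R :=
  \big[Num.max/f ord0]_(j < n.+1) f j.

Definition min_of (R : realFieldType) (n : nat) (f : 'I_n.+1 -> R) : R :=
  \big[Num.min/f ord0]_(j < n.+1) f j.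

Definition energy (R : realFieldType) (n m : nat) (I : platooning R n m)
    (s : solution n m) (j : 'I_n) : R :=
  rate I j * \sum_(i < m) len I i * (1 - reduction I (s i j)).

Definition feasible (R : realFieldType) (n m : nat) (I : platooning R n m)
    (s : solution n m) : Prop :=
  forall j, min_soc I j <= soc I j - energy I s j / capacity I j.

Definition max_energy (R : realFieldType) (n m : nat)
    (I : platooning R n.+1 m) (s : solution n.+1 m) : R :=
  max_of (energy I s).

Definition optimal (R : realFieldType) (n m : nat)
    (I : platooning R n.+1 m) (s : solution n.+1 m) : Prop :=
  feasible I s /\
  forall t, feasible I t -> max_energy I s <= max_energy I t.

(* In the following, [E j] is the energy used by vehicle j in the segments
   already treated by the algorithm, and i is the next segment to be treated. *)
Definition energy_after (R : realFieldType) (n m : nat) (I : platooning R n m)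
    (E : 'I_n -> R) (i : 'I_m) (j p : 'I_n) : R :=
  E j + len I i * rate I j * (1 - reduction I p).

Definition thresholds (R : realFieldType) (n m : nat) (I : platooning R n m)
    (E : 'I_n -> R) (i : 'I_m) : seq R :=
  sort <=%R
    (undup [seq energy_after I E i j p | j <- enum 'I_n, p <- enum 'I_n]).

(* A matching with n arcs of the bipartite graph on vehicles and positions is
   a permutation all of whose arcs (j, a j) belong to the graph. *)
Definition is_matching (R : realFieldType) (n m : nat) (I : platooning R n m)
    (E : 'I_n -> R) (i : 'I_m) (g : R) (a : {perm 'I_n}) : Prop :=
  forall j, energy_after I E i j (a j) <= g.

Definition bottleneck (R : realFieldType) (n m : nat) (I : platooning R n m)
    (E : 'I_n -> R) (i : 'I_m) (g : R) : Prop :=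
  [/\ g \in thresholds I E i,
      exists a, is_matching I E i g a
    & forall g' a, g' \in thresholds I E i ->
        is_matching I E i g' a -> g <= g'].

Definition bottleneck_assignment (R : realFieldType) (n m : nat)
    (I : platooning R n m) (E : 'I_n -> R) (i : 'I_m) (a : {perm 'I_n}) : Prop :=
  exists2 g, bottleneck I E i g & is_matching I E i g a.

Fixpoint heu2_run (R : realFieldType) (n m : nat) (I : platooning R n m)
    (s : solution n m) (E : 'I_n -> R) (segs : seq 'I_m) : Prop :=
  if segs is i :: segs' then
    bottleneck_assignment I E i (s i) /\
    heu2_run I s (fun j => energy_after I E i j (s i j)) segs'
  else True.

(* The algorithm leaves open the order of segments of equal length and the
   choice of a bottleneck matching; [heu2 I s] holds when s is produced by some
   such choices. [segs] lists the segments in the order of treatment, whereas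
   s is indexed by the original numbering of the segments. *)
Definition heu2 (R : realFieldType) (n m : nat) (I : platooning R n m)
    (s : solution n m) : Prop :=
  exists segs : seq 'I_m,
    [/\ perm_eq segs (enum 'I_m),
        sorted (fun i k => len I k <= len I i) segs
      & heu2_run I s (fun=> 0) segs].

(* Main.v *)
(** Write w_p = 1 - eta_p, M and mu for the maximum and minimum of delta_j w_j,
    and D for the total length.  Z^H <= M D: in each segment, putting vehicle j
    at position j raises no energy by more than M D_i, and the bottleneck
    assignment is at least as good.  Z* >= mu D: every solution satisfies
    sum_j U_j / delta_j = D sum_j w_j >= mu D sum_j 1 / delta_j, so not all the
    U_j can be smaller than mu D. *)

Require Import Defs.
From HB Require Import structures.
From mathcomp Require Import all_boot all_order all_algebra all_fingroup.

Set Implicit Arguments.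
Unset Strict Implicit.
Unset Printing Implicit Defensive.

Import Order.TTheory GRing.Theory Num.Theory.
Local Open Scope ring_scope.

(** The bound [c] may fail to be a threshold, but the largest energy that [b] produces is one and is
    at most [c]. Since [b] is a matching at that threshold, the bottleneck value cannot exceed
    it. *)
Lemma bottleneck_assignment_le (R : realFieldType) (n m : nat)
    (I : platooning R n m) (E : 'I_n -> R) (i : 'I_m) (a b : {perm 'I_n}) (c : R) :
  bottleneck_assignment I E i a -> is_matching I E i c b -> is_matching I E i c a.
Proof.
move=> [g [_ _ g_min] ag] bc j; apply: le_trans (ag j) _.
case: (@Order.TotalTheory.arg_maxP _ _ _ j xpredT
         (fun k => energy_after I E i k (b k)) erefl) => k _ k_max.
apply: le_trans (bc k); apply: (g_min _ b) => [|l]; last exact: k_max.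
rewrite mem_sort mem_undup; apply: allpairs_f; exact: mem_enum.
Qed.

(** Induction on the segments, with [E] and [c] general: the fixed assignment [b] would raise the
    uniform bound [c] by at most [K * len I i] in segment [i], so the bottleneck assignment does not
    exceed that bound either. *)
Lemma heu2_run_le (R : realFieldType) (n m : nat) (I : platooning R n m)
    (s : solution n m) (b : {perm 'I_n}) (K : R)
    (bK : forall j, rate I j * (1 - reduction I (b j)) <= K)
    (segs : seq 'I_m) (E : 'I_n -> R) (c : R) :
  (forall j, E j <= c) -> heu2_run I s E segs ->
  forall j, E j + rate I j * \sum_(i <- segs) len I i * (1 - reduction I (s i j))
            <= c + K * \sum_(i <- segs) len I i.
Proof.
elim: segs E c => [|i segs IH] E c Ec /= => [_ j|[sa run] j].
  by rewrite !big_nil !mulr0 !addr0.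
have Ec' k : energy_after I E i k (s i k) <= c + K * len I i.
  apply: (bottleneck_assignment_le sa) => l; rewrite /energy_after lerD //.
  by rewrite -mulrA mulrC ler_wpM2r ?bK // ltW ?len_gt0.
rewrite !big_cons [rate I j * _]mulrDr [K * _]mulrDr !addrA.
apply: le_trans _ (IH _ _ Ec' run j).
by rewrite /energy_after mulrA [rate I j * len I i]mulrC.
Qed.

Lemma max_energy_heu2_le (R : realFieldType) (n m : nat)
    (I : platooning R n.+1 m) (s : solution n.+1 m) (b : {perm 'I_n.+1}) (K : R) :
  (forall j, rate I j * (1 - reduction I (b j)) <= K) -> heu2 I s ->
  max_energy I s <= K * \sum_i len I i.
Proof.
move=> bK [segs [segsE _ run]].
have sum_segs (F : 'I_m -> R) : \sum_(i <- segs) F i = \sum_i F i.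
  by rewrite (perm_big _ segsE) big_enum.
have energy_le j : energy I s j <= K * \sum_i len I i.
  have := heu2_run_le bK (fun=> lexx 0) run j.
  by rewrite !add0r !sum_segs.
by apply: bigmax_le => [|j _]; exact: energy_le.
Qed.

(** Once the rates are divided out, each segment contributes a sum over positions, which its
    permutation only reorders. *)
Lemma sum_energy_div_rate (R : realFieldType) (n m : nat) (I : platooning R n m)
    (s : solution n m) :
  \sum_j energy I s j / rate I j
  = (\sum_i len I i) * \sum_p (1 - reduction I p).
Proof.
under eq_bigr => j _ do rewrite /energy mulrAC mulfV ?mul1r ?gt_eqF ?rate_gt0 //.
rewrite exchange_big mulr_suml; apply: eq_bigr => i _.
by rewrite -mulr_sumr; congr (_ * _); rewrite [RHS](reindex_inj (@perm_inj _ (s i))).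
Qed.

Lemma max_energy_ge (R : realFieldType) (n m : nat) (I : platooning R n.+1 m)
    (s : solution n.+1 m) (b : {perm 'I_n.+1}) (K : R) :
  (forall j, K <= rate I j * (1 - reduction I (b j))) ->
  K * \sum_i len I i <= max_energy I s.
Proof.
move=> bK; rewrite leNgt; apply/negP => lt_max.
have D_ge0 : 0 <= \sum_i len I i by apply: sumr_ge0 => i _; rewrite ltW ?len_gt0.
suff : \sum_j energy I s j / rate I j < \sum_j energy I s j / rate I j.
  by rewrite ltxx.
apply: (@lt_le_trans _ _ (\sum_j (K * \sum_i len I i) / rate I j)).
  apply: ltr_sum => [|j _]; first by apply/hasP; exists ord0; rewrite ?mem_index_enum.
  rewrite ltr_pM2r ?invr_gt0 ?rate_gt0 //; apply: le_lt_trans lt_max.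
  exact: le_bigmax.
(* Summing over positions as [b j] pairs each vehicle with its own position, and the hypothesis on
   [K] then applies term by term. *)
rewrite sum_energy_div_rate [leRHS]mulr_sumr [leRHS](reindex_inj (@perm_inj _ b)).
apply: ler_sum => j _; rewrite mulrAC mulrC ler_wpM2l //.
by rewrite ler_pdivrMr ?rate_gt0 // mulrC.
Qed.

Theorem proposition20 (R : realFieldType) (n m : nat)
    (I : platooning R n.+1 m.+1)
    (L : R)
    (L_large : (forall j, L <= soc I j * capacity I j) ->
               forall s : solution n.+1 m.+1, feasible I s)
    (soc_large : forall j, L <= soc I j * capacity I j)
    (v : {perm 'I_n.+1})
    (v_sorted : forall j k : 'I_n.+1, (j <= k)%N ->
                rate I (v j) <= rate I (v k))
    (sH sopt : solution n.+1 m.+1)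
    (sH_heu2 : heu2 I sH)
    (sopt_optimal : optimal I sopt) :
  max_energy I sH / max_energy I sopt <=
    max_of (fun j => rate I (v j) * (1 - reduction I j)) /
    min_of (fun j => rate I (v j) * (1 - reduction I j)).
Proof.
set f := fun j => rate I (v j) * (1 - reduction I j).
(* Vehicle [v k] has rank [k] by rate, so [v^-1] sends each vehicle to the position equal to its
   rank; it is the reference assignment for both bounds. *)
have fV j : rate I j * (1 - reduction I (v^-1%g j)) = f (v^-1%g j).
  by rewrite /f permKV.
have f_gt0 j : 0 < f j by rewrite mulr_gt0 ?rate_gt0 // subr_gt0 reduction_lt1.
have min_gt0 : 0 < min_of f by apply: lt_bigmin => // j _.
(* With [m.+1] segments there is a first one; its positive length makes the optimum positive. *)
have D_gt0 : 0 < \sum_i len I i.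
  rewrite big_ord_recl ltr_pwDl ?len_gt0 //.
  by apply: sumr_ge0 => i _; rewrite ltW ?len_gt0.
have ZH_le : max_energy I sH <= max_of f * \sum_i len I i.
  apply: (@max_energy_heu2_le _ _ _ _ _ v^-1%g) => // j.
  by rewrite fV; exact: le_bigmax.
have Zopt_ge : min_of f * \sum_i len I i <= max_energy I sopt.
  apply: (@max_energy_ge _ _ _ _ _ v^-1%g) => j.
  by rewrite fV; exact: bigmin_le.
have Zopt_gt0 : 0 < max_energy I sopt by apply: lt_le_trans Zopt_ge; exact: mulr_gt0.
have max_ge0 : 0 <= max_of f.
  by apply: le_trans (ltW (f_gt0 ord0)) _; exact: le_bigmax.
(* After clearing denominators, both sides are compared with [max_of f * min_of f] times the total
   length. *)
rewrite ler_pdivrMr // mulrAC ler_pdivlMr //.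
apply: le_trans (ler_wpM2r (ltW min_gt0) ZH_le) _.
by rewrite -mulrA [_ * min_of f]mulrC ler_wpM2l.
Qed.
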